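(* Let $(A,\mu_A)$ and $(B,\mu_B)$ be two partially associative $3$-ary algebras over $\mathcal{K}$. Suppose there are linear maps $L_A:A\otimes A\otimes B\to B$, $R_A:B\otimes A\otimes A\to B$, $M_A:A\otimes B\otimes A\to B$ and $L_B:B\otimes B\otimes A\to A$, $R_B:A\otimes B\otimes B\to A$, $M_B:B\otimes A\otimes B\to A$ such that $(L_A,M_A,R_A,B)$ is a quasi trimodule of $(A,\mu_A)$, $(L_B,M_B,R_B,A)$ is a quasi trimodule of $(B,\mu_B)$, and for all $x,y,z\in A$, $a,b,c\in B$: 1. $\mu_A(L_B(a,b)(x),y,z)+L_B(a,R_A(x,y)(b))(z)+L_B(a,b)(\mu_A(x,y,z))=0$, 2. $\mu_A(M_B(a,b)(x),y,z)+L_B(a,M_A(x,y)(b))(z)+M_B(a,R_A(y,z)(b))(x)=0$, 3. $\mu_A(R_B(a,b)(x),y,z)+\mu_A(x,L_B(a,b)(y),z)+R_B(a,R_A(y,z)(b))(x)=0$, 4. $L_B(L_A(x,y)(a),b)(z)+\mu_A(x,R_B(a,b)(y),z)+\mu_A(x,y,L_B(a,b)(z))=0$, 5. $L_B(M_A(x,y)(a),b)(z)+\mu_A(x,M_B(a,b)(y),z)+R_B(a,M_A(y,z)(b))(x)=0$, 6. $L_B(R_A(x,y)(a),b)(z)+L_B(a,L_A(x,y)(b))(z)+M_B(a,M_A(y,z)(b))(x)=0$, 7. $M_B(L_A(x,y)(a),b)(z)+R_B(M_A(y,z)(a),b)(x)+\mu_A(x,y,M_B(a,b)(z))=0$, 8.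 $M_B(M_A(x,y)(a),b)(z)+R_B(R_A(y,z)(a),b)(x)+R_B(a,L_A(y,z)(b))(x)=0$, 9. $M_B(R_A(x,y)(a),b)(z)+M_B(a,b)(\mu_A(x,y,z))+M_B(a,L_A(y,z)(b))(x)=0$, 10. $R_B(a,b)(\mu_A(x,y,z))+R_B(L_A(y,z)(a),b)(x)+\mu_A(x,y,R_B(a,b)(z))=0$, 11. $\mu_B(L_A(x,y)(a),b,c)+L_A(x,R_B(a,b)(y))(c)+L_A(x,y)(\mu_B(a,b,c))=0$, 12. $\mu_B(M_A(x,y)(a),b,c)+L_A(x,M_B(a,b)(y))(c)+M_A(x,R_B(b,c)(y))(a)=0$, 13. $\mu_B(R_A(x,y)(a),b,c)+\mu_B(a,L_A(x,y)(b),c)+R_A(x,R_B(b,c)(y))(a)=0$, 14. $L_A(L_B(a,b)(x),y)(c)+\mu_B(a,R_A(x,y)(b),c)+\mu_B(a,b,L_A(x,y)(c))=0$, 15. $L_A(M_B(a,b)(x),y)(c)+\mu_B(a,M_A(x,y)(b),c)+R_A(x,M_B(b,c)(y))(a)=0$, 16. $L_A(R_B(a,b)(x),y)(c)+L_A(x,L_B(a,b)(y))(c)+M_A(x,M_B(b,c)(y))(a)=0$, 17. $M_A(L_B(a,b)(x),y)(c)+R_A(M_B(b,c)(x),y)(a)+\mu_B(a,b,M_A(x,y)(c))=0$, 18. $M_A(M_B(a,b)(x),y)(c)+R_A(R_B(b,c)(x),y)(a)+R_A(x,L_B(b,c)(y))(a)=0$, 19. $M_A(R_B(a,b)(x),y)(c)+M_A(x,y)(\mu_B(a,b,c))+M_A(x,L_B(b,c)(y))(a)=0$,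 20. $R_A(x,y)(\mu_B(a,b,c))+R_A(L_B(b,c)(x),y)(a)+\mu_B(a,b,R_A(x,y)(c))=0$. Then the direct sum $A\oplus B$ is a partially associative $3$-ary algebra under the product $$\begin{aligned}\tau[(x+a),(y+b),(z+c)]=&\,[\mu_A(x,y,z)+L_B(a,b)(z)+M_B(a,c)(y)+R_B(b,c)(x)]\\&+[\mu_B(a,b,c)+L_A(x,y)(c)+M_A(x,z)(b)+R_A(y,z)(a)],\end{aligned}$$ for $x,y,z\in A$, $a,b,c\in B$.
   Context: $\mathcal{K}$ is a fixed field of characteristic zero. A partially associative $3$-ary algebra is a $\mathcal{K}$-vector space $A$ with a trilinear operation $\mu$ satisfying $\mu(\mu(x_1,x_2,x_3),x_4,x_5)+\mu(x_1,\mu(x_2,x_3,x_4),x_5)+\mu(x_1,x_2,\mu(x_3,x_4,x_5))=0$ for all $x_i\in A$. For linear maps $L:A\otimes A\otimes V\to V$, $M:A\otimes V\otimes A\to V$, $R:V\otimes A\otimes A\to V$ one writes $L(x,y)(v)$, $M(x,y)(v)$, $R(x,y)(v)$ for the values at $x\otimes y\otimes v$, $x\otimes v\otimes y$, $v\otimes x\otimes y$. $(L,M,R,V)$ is a quasi trimodule of the partially associative $3$-ary algebra $(A,\mu)$ if for all $a,b,c,d\in A$, $v\in V$: $L(a,b)(L(c,d)(v))+L(\mu(a,b,c),d)(v)+L(a,\mu(b,c,d))(v)=0$; $R(c,d)(R(a,b)(v))+R(a,\mu(b,c,d))(v)+R(\mu(a,b,c),d)(v)=0$; $M(a,d)(L(b,c)(v))+L(a,b)(M(c,d)(v))+M(\mu(a,b,c),d)(v)=0$;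 $M(a,d)(R(b,c)(v))+R(c,d)(M(a,b)(v))+M(a,\mu(b,c,d))(v)=0$; $R(c,d)(L(a,b)(v))+L(a,b)(R(c,d)(v))+M(a,d)(M(b,c)(v))=0$. (A trimodule additionally satisfies $M(a,z)(M(b,y)(M(c,x)(v)))=M(\mu(a,b,c),\mu(x,y,z))(v)$; for a quasi trimodule this is not required.) *)

(* Defs.v *)
From mathcomp Require Import all_boot all_algebra.

Set Implicit Arguments.
Unset Strict Implicit.
Unset Printing Implicit Defensive.

Import GRing.Theory.
Local Open Scope ring_scope.

(* Linear maps out of U1 (x) U2 (x) U3 are represented, via the universal
   property of the tensor product, by curried trilinear maps. *)
Definition trilinear (K : fieldType) (U1 U2 U3 W : lmodType K)
    (f : U1 -> U2 -> U3 -> W) : Prop :=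
  [/\ forall u2 u3, linear (fun u1 => f u1 u2 u3),
      forall u1 u3, linear (fun u2 => f u1 u2 u3)
    & forall u1 u2, linear (fun u3 => f u1 u2 u3)].

Record partially_associative (K : fieldType) (A : lmodType K)
    (mu : A -> A -> A -> A) : Prop := PartiallyAssociative {
  pa_trilinear : trilinear mu;
  pa_identity : forall x1 x2 x3 x4 x5 : A,
    mu (mu x1 x2 x3) x4 x5 + mu x1 (mu x2 x3 x4) x5
      + mu x1 x2 (mu x3 x4 x5) = 0 }.

(* The curried maps take the algebra arguments first and the module argument
   last: L x y v, M x y v and R x y v are the values of the linear maps L, M, R
   at x (x) y (x) v, at x (x) v (x) y and at v (x) x (x) y respectively. *)
Record quasi_trimodule (K : fieldType) (A : lmodType K) (mu : A -> A -> A -> A)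
    (V : lmodType K) (L M R : A -> A -> V -> V) : Prop := QuasiTrimodule {
  qt_trilinearL : trilinear L;
  qt_trilinearM : trilinear M;
  qt_trilinearR : trilinear R;
  qt_LL : forall (a b c d : A) (v : V),
    L a b (L c d v) + L (mu a b c) d v + L a (mu b c d) v = 0;
  qt_RR : forall (a b c d : A) (v : V),
    R c d (R a b v) + R a (mu b c d) v + R (mu a b c) d v = 0;
  qt_ML : forall (a b c d : A) (v : V),
    M a d (L b c v) + L a b (M c d v) + M (mu a b c) d v = 0;
  qt_MR : forall (a b c d : A) (v : V),
    M a d (R b c v) + R c d (M a b v) + M a (mu b c d) v = 0;
  qt_RLMM : forall (a b c d : A) (v : V),
    R c d (L a b v) + L a b (R c d v) + M a d (M b c v) = 0 }.

(* The direct sum of A and B is the product module A * B; x + a is (x, a). *)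
Definition dsum_product (K : fieldType) (A B : lmodType K)
    (muA : A -> A -> A -> A) (muB : B -> B -> B -> B)
    (LA MA RA : A -> A -> B -> B) (LB MB RB : B -> B -> A -> A)
    (u v w : A * B) : A * B :=
  let: (x, a) := u in let: (y, b) := v in let: (z, c) := w in
  (muA x y z + LB a b z + MB a c y + RB b c x,
   muB a b c + LA x y c + MA x z b + RA y z a).

(* Main.v *)
(* The associator is additive in each of its five arguments, so it suffices to
   evaluate it on elements of A or of B. On each of the 32 types of pure tuples
   the three terms are single iterated products lying in the same summand, and
   their sum vanishes by partial associativity (no argument, or all
   five, in B), by a quasi trimodule axiom (one argument in B, or one in A), or
   by one of the twenty compatibility conditions. *)
Require Import Defs.
From mathcomp Require Import all_boot all_algebra.

Set Implicit Arguments.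
Unset Strict Implicit.
Unset Printing Implicit Defensive.

Import GRing.Theory.
Local Open Scope ring_scope.

Section Trilinear.

Variables (K : fieldType) (U1 U2 U3 W : lmodType K).
Implicit Type f : U1 -> U2 -> U3 -> W.

(** The partial maps of a trilinear map satisfy [linear] only as a bare predicate, so additivity is
    extracted from it by taking the scalar 1. *)
Lemma linear_fun_add (U V : lmodType K) (f : U -> V) :
  linear f -> {morph f : u v / u + v}.
Proof. by move=> fL u v; have := fL 1 u v; rewrite !scale1r. Qed.

Lemma linear_fun_0 (U V : lmodType K) (f : U -> V) : linear f -> f 0 = 0.
Proof. by move=> /linear_fun_add fD; apply: (addrI (f 0)); rewrite -fD !addr0. Qed.

Lemma trilinear_addr f : trilinear f ->
  [/\ forall u v y z, f (u + v) y z = f u y z + f v y z,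
      forall x u v z, f x (u + v) z = f x u z + f x v z
    & forall x y u v, f x y (u + v) = f x y u + f x y v].
Proof.
case=> f1 f2 f3; split=> [u v y z|x u v z|x y u v].
- exact: (linear_fun_add (f1 y z)).
- exact: (linear_fun_add (f2 x z)).
- exact: (linear_fun_add (f3 x y)).
Qed.

Lemma trilinear0 f : trilinear f ->
  [/\ forall y z, f 0 y z = 0, forall x z, f x 0 z = 0 & forall x y, f x y 0 = 0].
Proof.
case=> f1 f2 f3; split=> [y z|x z|x y].
- exact: (linear_fun_0 (f1 y z)).
- exact: (linear_fun_0 (f2 x z)).
- exact: (linear_fun_0 (f3 x y)).
Qed.

Lemma trilinear_add f g : trilinear f -> trilinear g ->
  trilinear (fun x y z => f x y z + g x y z).
Proof.
by move=> [f1 f2 f3] [g1 g2 g3]; split=> ? ? k u v /=;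
  rewrite ?(f1, f2, f3) ?(g1, g2, g3) scalerDr addrACA.
Qed.

Lemma trilinear_pair (W' : lmodType K) f (g : U1 -> U2 -> U3 -> W') :
  trilinear f -> trilinear g -> trilinear (fun x y z => (f x y z, g x y z)).
Proof.
by move=> [f1 f2 f3] [g1 g2 g3]; split=> ? ? k u v /=;
  rewrite ?(f1, f2, f3) ?(g1, g2, g3).
Qed.

Lemma trilinear_comp (V1 V2 V3 : lmodType K) (p1 : {linear V1 -> U1})
    (p2 : {linear V2 -> U2}) (p3 : {linear V3 -> U3}) f :
  trilinear f -> trilinear (fun x y z => f (p1 x) (p2 y) (p3 z)).
Proof.
by move=> [f1 f2 f3]; split=> ? ? k u v; rewrite linearP ?(f1, f2, f3).
Qed.

(** The curried middle and right actions take the module argument last, although it stands second or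
    first in the ternary product. This permutation and [trilinear_rot] restore the order of the
    product. *)
Lemma trilinear_swap f : trilinear f -> trilinear (fun x z y => f x y z).
Proof. by case=> f1 f2 f3; split=> ? ?; [exact: f1|exact: f3|exact: f2]. Qed.

Lemma trilinear_rot f : trilinear f -> trilinear (fun z x y => f x y z).
Proof. by case=> f1 f2 f3; split=> ? ?; [exact: f3|exact: f1|exact: f2]. Qed.

End Trilinear.

(** Homogeneous elements are indexed by the sum type, so that the summand an argument lies in can be
    found by case analysis. *)
Definition pure (A B : zmodType) (s : A + B) : A * B :=
  match s with inl x => (x, 0) | inr a => (0, a) end.

(** Each pair is the sum of its two homogeneous components. *)
Lemma morph_add_pure_eq0 (A B C : zmodType) (f : A * B -> C) :
    {morph f : u v / u + v} -> (forall s, f (pure s) = 0) -> forall u, f u = 0.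
Proof.
move=> fD f0 [x a].
have -> : (x, a) = pure (inl x) + pure (inr a).
  by apply: injective_projections; rewrite /= (addr0, add0r).
by rewrite fD !f0 addr0.
Qed.

Definition associator (A : zmodType) (mu : A -> A -> A -> A)
    (u1 u2 u3 u4 u5 : A) : A :=
  mu (mu u1 u2 u3) u4 u5 + mu u1 (mu u2 u3 u4) u5 + mu u1 u2 (mu u3 u4 u5).

Lemma associator_pair_eq0 (K : fieldType) (A B : lmodType K)
    (mu : A * B -> A * B -> A * B -> A * B) :
    trilinear mu ->
    (forall s1 s2 s3 s4 s5 : A + B,
      associator mu (pure s1) (pure s2) (pure s3) (pure s4) (pure s5) = 0) ->
  forall u1 u2 u3 u4 u5, associator mu u1 u2 u3 u4 u5 = 0.
Proof.
move=> /trilinear_addr[mu1 mu2 mu3] mu0 u1 u2 u3 u4 u5.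
(* Expanding one argument splits each of the three terms in two; this regroups the six summands into
   two associators. *)
have DD (a b c d e f : A * B) : a + b + (c + d) + (e + f) = a + c + e + (b + d + f).
  by rewrite [a + b + _]addrACA [LHS]addrACA.
move: u1; apply: morph_add_pure_eq0 => [u v|s1].
  by rewrite /associator !(mu1, mu2, mu3) DD.
move: u2; apply: morph_add_pure_eq0 => [u v|s2].
  by rewrite /associator !(mu1, mu2, mu3) DD.
move: u3; apply: morph_add_pure_eq0 => [u v|s3].
  by rewrite /associator !(mu1, mu2, mu3) DD.
move: u4; apply: morph_add_pure_eq0 => [u v|s4].
  by rewrite /associator !(mu1, mu2, mu3) DD.
move: u5; apply: morph_add_pure_eq0 => [u v|s5].
  by rewrite /associator !(mu1, mu2, mu3) DD.
exact: mu0.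
Qed.

Lemma trilinear_dsum_product (K : fieldType) (A B : lmodType K)
    (muA : A -> A -> A -> A) (muB : B -> B -> B -> B)
    (LA MA RA : A -> A -> B -> B) (LB MB RB : B -> B -> A -> A) :
    trilinear muA -> trilinear muB ->
    trilinear LA -> trilinear MA -> trilinear RA ->
    trilinear LB -> trilinear MB -> trilinear RB ->
  trilinear (dsum_product muA muB LA MA RA LB MB RB).
Proof.
move=> tA tB tLA tMA tRA tLB tMB tRB.
(* With the coordinates written as linear projections, each of the eight summands is a trilinear map
   composed with projections, up to the order of its arguments. *)
pose p1 : {linear (A * B)%type -> A} := fst.
pose p2 : {linear (A * B)%type -> B} := snd.
have [f1 f2 f3] : trilinear (fun u v w : A * B =>
    (muA (p1 u) (p1 v) (p1 w) + LB (p2 u) (p2 v) (p1 w)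
       + MB (p2 u) (p2 w) (p1 v) + RB (p2 v) (p2 w) (p1 u),
     muB (p2 u) (p2 v) (p2 w) + LA (p1 u) (p1 v) (p2 w)
       + MA (p1 u) (p1 w) (p2 v) + RA (p1 v) (p1 w) (p2 u))).
  apply: trilinear_pair; apply: trilinear_add; try apply: trilinear_add;
    try apply: trilinear_add; try exact: trilinear_comp.
  (* Only the middle and right actions remain, since their arguments are permuted. *)
  - exact/(trilinear_swap (trilinear_comp _ _ _ tMB)).
  - exact/(trilinear_rot (trilinear_comp _ _ _ tRB)).
  - exact/(trilinear_swap (trilinear_comp _ _ _ tMA)).
  - exact/(trilinear_rot (trilinear_comp _ _ _ tRA)).
(* [dsum_product] destructures its arguments, so it agrees with the projection form by computation
   once these are explicit pairs. *)
split=> -[y b] [z c] k [x a] [x' a'].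
- exact: (f1 (y, b) (z, c) k (x, a) (x', a')).
- exact: (f2 (y, b) (z, c) k (x, a) (x', a')).
- exact: (f3 (y, b) (z, c) k (x, a) (x', a')).
Qed.

Section PureProducts.

Variables (K : fieldType) (A B : lmodType K).
Variables (muA : A -> A -> A -> A) (muB : B -> B -> B -> B).
Variables (LA MA RA : A -> A -> B -> B) (LB MB RB : B -> B -> A -> A).
Hypotheses (tA : trilinear muA) (tB : trilinear muB).
Hypotheses (tLA : trilinear LA) (tMA : trilinear MA) (tRA : trilinear RA).
Hypotheses (tLB : trilinear LB) (tMB : trilinear MB) (tRB : trilinear RB).

(** The product is graded by Z/2, with [A] even and [B] odd: the result lies in [B] exactly when an
    odd number of factors does. *)
Definition pure_product (s1 s2 s3 : A + B) : A + B :=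
  match s1, s2, s3 with
  | inl x, inl y, inl z => inl (muA x y z)
  | inr a, inr b, inl z => inl (LB a b z)
  | inr a, inl y, inr c => inl (MB a c y)
  | inl x, inr b, inr c => inl (RB b c x)
  | inr a, inr b, inr c => inr (muB a b c)
  | inl x, inl y, inr c => inr (LA x y c)
  | inl x, inr b, inl z => inr (MA x z b)
  | inr a, inl y, inl z => inr (RA y z a)
  end.

(** Of the eight terms of the product, exactly one has no zero argument when the factors are
    homogeneous. *)
Lemma dsum_product_pure s1 s2 s3 :
  dsum_product muA muB LA MA RA LB MB RB (pure s1) (pure s2) (pure s3)
    = pure (pure_product s1 s2 s3).
Proof.
have [[A1 A2 A3] [B1 B2 B3]] := (trilinear0 tA, trilinear0 tB).
have [[LA1 LA2 LA3] [LB1 LB2 LB3]] := (trilinear0 tLA, trilinear0 tLB).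
have [[MA1 MA2 MA3] [MB1 MB2 MB3]] := (trilinear0 tMA, trilinear0 tMB).
have [[RA1 RA2 RA3] [RB1 RB2 RB3]] := (trilinear0 tRA, trilinear0 tRB).
case: s1 s2 s3 => [x|a] [y|b] [z|c]; apply: injective_projections => /=;
  by rewrite ?(A1, B1, LA1, LB1, MA1, MB1, RA1, RB1) ?(A2, B2, LA2, LB2, MA2,
    MB2, RA2, RB2) ?(A3, B3, LA3, LB3, MA3, MB3, RA3, RB3) ?addr0 ?add0r.
Qed.

End PureProducts.

Theorem theorem3p13 (K : fieldType) (charK0 : [pchar K] =i pred0)
    (A B : lmodType K)
    (muA : A -> A -> A -> A) (muB : B -> B -> B -> B)
    (paA : partially_associative muA) (paB : partially_associative muB)
    (LA MA RA : A -> A -> B -> B) (LB MB RB : B -> B -> A -> A)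
    (qtA : quasi_trimodule muA LA MA RA)
    (qtB : quasi_trimodule muB LB MB RB)
    (h1 : forall (x y z : A) (a b : B),
      muA (LB a b x) y z + LB a (RA x y b) z + LB a b (muA x y z) = 0)
    (h2 : forall (x y z : A) (a b : B),
      muA (MB a b x) y z + LB a (MA x y b) z + MB a (RA y z b) x = 0)
    (h3 : forall (x y z : A) (a b : B),
      muA (RB a b x) y z + muA x (LB a b y) z + RB a (RA y z b) x = 0)
    (h4 : forall (x y z : A) (a b : B),
      LB (LA x y a) b z + muA x (RB a b y) z + muA x y (LB a b z) = 0)
    (h5 : forall (x y z : A) (a b : B),
      LB (MA x y a) b z + muA x (MB a b y) z + RB a (MA y z b) x = 0)
    (h6 : forall (x y z : A) (a b : B),
      LB (RA x y a) b z + LB a (LA x y b) z + MB a (MA y z b) x = 0)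
    (h7 : forall (x y z : A) (a b : B),
      MB (LA x y a) b z + RB (MA y z a) b x + muA x y (MB a b z) = 0)
    (h8 : forall (x y z : A) (a b : B),
      MB (MA x y a) b z + RB (RA y z a) b x + RB a (LA y z b) x = 0)
    (h9 : forall (x y z : A) (a b : B),
      MB (RA x y a) b z + MB a b (muA x y z) + MB a (LA y z b) x = 0)
    (h10 : forall (x y z : A) (a b : B),
      RB a b (muA x y z) + RB (LA y z a) b x + muA x y (RB a b z) = 0)
    (h11 : forall (x y : A) (a b c : B),
      muB (LA x y a) b c + LA x (RB a b y) c + LA x y (muB a b c) = 0)
    (h12 : forall (x y : A) (a b c : B),
      muB (MA x y a) b c + LA x (MB a b y) c + MA x (RB b c y) a = 0)
    (h13 : forall (x y : A) (a b c : B),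
      muB (RA x y a) b c + muB a (LA x y b) c + RA x (RB b c y) a = 0)
    (h14 : forall (x y : A) (a b c : B),
      LA (LB a b x) y c + muB a (RA x y b) c + muB a b (LA x y c) = 0)
    (h15 : forall (x y : A) (a b c : B),
      LA (MB a b x) y c + muB a (MA x y b) c + RA x (MB b c y) a = 0)
    (h16 : forall (x y : A) (a b c : B),
      LA (RB a b x) y c + LA x (LB a b y) c + MA x (MB b c y) a = 0)
    (h17 : forall (x y : A) (a b c : B),
      MA (LB a b x) y c + RA (MB b c x) y a + muB a b (MA x y c) = 0)
    (h18 : forall (x y : A) (a b c : B),
      MA (MB a b x) y c + RA (RB b c x) y a + RA x (LB b c y) a = 0)
    (h19 : forall (x y : A) (a b c : B),
      MA (RB a b x) y c + MA x y (muB a b c) + MA x (LB b c y) a = 0)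
    (h20 : forall (x y : A) (a b c : B),
      RA x y (muB a b c) + RA (LB b c x) y a + muB a b (RA x y c) = 0) :
  partially_associative (dsum_product muA muB LA MA RA LB MB RB).
Proof.
case: paA paB qtA qtB => tA asA [tB asB].
case=> tLA tMA tRA LLA RRA MLA MRA RLMMA [tLB tMB tRB LLB RRB MLB MRB RLMMB].
have tmu := trilinear_dsum_product tA tB tLA tMA tRA tLB tMB tRB.
split=> //; apply: associator_pair_eq0 => // s1 s2 s3 s4 s5 /=.
rewrite /associator !dsum_product_pure //.
(* The three terms of an associator have the same parity, so their sum can be taken inside a single
   [pure], leaving an equation in [A] or in [B]. *)
have pureDl (x y : A) : pure (inl x) + pure (inl y) = pure (inl (x + y)) :> A * B.
  by apply: injective_projections; rewrite /= ?addr0.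
have pureDr (a b : B) : pure (inr a) + pure (inr b) = pure (inr (a + b)) :> A * B.
  by apply: injective_projections; rewrite /= ?addr0.
have purel0 (x : A) : x = 0 -> pure (inl x) = 0 :> A * B by move=> ->.
have purer0 (a : B) : a = 0 -> pure (inr a) = 0 :> A * B by move=> ->.
case: s1 s2 s3 s4 s5 => [x1|a1] [x2|a2] [x3|a3] [x4|a4] [x5|a5];
  rewrite /pure_product ?(pureDl, pureDr); (apply: purel0 || apply: purer0).
(* The twenty conditions cover two or three arguments in [B]. When one argument is alone in its
   summand, its position from first to fifth selects the axiom RR, MR, RLMM, ML or LL; these list
   the three terms in another order, hence the permutations. *)
all: first
  [ exact: asA | exact: asB
  | exact: h1 | exact: h2 | exact: h3 | exact: h4 | exact: h5
  | exact: h6 | exact: h7 | exact: h8 | exact: h9 | exact: h10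
  | exact: h11 | exact: h12 | exact: h13 | exact: h14 | exact: h15
  | exact: h16 | exact: h17 | exact: h18 | exact: h19 | exact: h20
  | by rewrite addrC addrA; first [exact: LLA | exact: LLB]
  | by rewrite addrAC; first [exact: RRA | exact: RRB | exact: RLMMA | exact: RLMMB]
  | by rewrite -addrA addrC; first [exact: MLA | exact: MLB]
  | by rewrite [X in X + _]addrC; first [exact: MRA | exact: MRB] ].
Qed.
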